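(* Let $U\subseteq\mathbb{R}^2$ be a nonempty connected open set with coordinates $(x^1,x^2)$, and let $\hat{\Theta}$ be the set of smooth vector fields $\xi=\xi^1\partial_1+\xi^2\partial_2$ on $U$ satisfying the linear system of $14$ partial differential equations $$\partial_{ijr}\xi^k=0\quad (k,i,j,r\in\{1,2\}),$$ $$\partial_{22}\xi^2-\partial_{12}\xi^1=0,\quad \partial_{22}\xi^1+\partial_{12}\xi^2=0,\quad \partial_{12}\xi^2-\partial_{11}\xi^1=0,\quad \partial_{12}\xi^1+\partial_{11}\xi^2=0,$$ $$\partial_2\xi^2-\partial_1\xi^1=0,\quad \partial_2\xi^1+\partial_1\xi^2=0 .$$ Then $\hat{\Theta}$ is a real vector space of dimension $6$, with basis $$\partial_1,\quad \partial_2,\quad x^1\partial_2-x^2\partial_1,\quad x^1\partial_1+x^2\partial_2,\quad \theta_1,\quad \theta_2,$$ where $$\theta_1=\tfrac12\big((x^1)^2-(x^2)^2\big)\partial_1+x^1x^2\,\partial_2,\qquad \theta_2=x^1x^2\,\partial_1+\tfrac12\big((x^2)^2-(x^1)^2\big)\partial_2$$ (that is, $2$ translations, $1$ rotation, $1$ dilatation and $2$ elations). Moreover $\hat{\Theta}$ is closed under the Lie bracket of vector fields, i.e. $[\hat{\Theta},\hat{\Theta}]\subset\hat{\Theta}$, and in particular $$[\partial_1,\theta_1]=x^1\partial_1+x^2\partial_2,\quad [\partial_2,\theta_1]=x^1\partial_2-x^2\partial_1,$$ $$[x^1\partial_2-x^2\partial_1,\theta_1]=-\theta_2,\quad [x^1\partial_1+x^2\partial_2,\theta_1]=\theta_1,\quad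 [\theta_1,\theta_2]=0.$$
   Context: Notation: $\partial_i=\partial/\partial x^i$, and $\partial_{ij}$, $\partial_{ijr}$ denote the iterated partial derivatives; $\partial_i$ also denotes the $i$-th coordinate vector field. Because partial derivatives commute, the equations $\partial_{ijr}\xi^k=0$ amount to $8$ independent third order equations, which together with the $4$ second order and $2$ first order equations make $14$. The bracket is the usual Lie bracket of vector fields, $[\xi,\eta]^k=\xi^r\partial_r\eta^k-\eta^r\partial_r\xi^k$ (summation over $r$). *)

(* Defs.v *)
From HB Require Import structures.
From mathcomp Require Import all_boot all_order all_algebra.
From mathcomp Require Import all_classical all_reals all_analysis.

Set Implicit Arguments.
Unset Strict Implicit.
Unset Printing Implicit Defensive.

Import Order.TTheory GRing.Theory Num.Theory.
Import numFieldNormedType.Exports.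

Local Open Scope classical_set_scope.
Local Open Scope ring_scope.

(* Points of the plane are row vectors; the coordinates x^1 and x^2 are the    *)
(* entries at the indices i1 and i2.                                           *)
Definition i1 : 'I_2 := ord0.
Definition i2 : 'I_2 := ord_max.

(* Functions and vector fields are defined on U only (as functions on the      *)
(* subtype attached to U), so that equality of fields is equality on U and     *)
(* the pointwise operations make them a real vector space.                     *)
Notation vfield R U := (set_type U -> 'rV[R]_2) (only parsing).

Section Calculus.
Variables (R : realType) (U : set 'rV[R]_2).
Implicit Types (f : U -> R) (xi eta : vfield R U) (x : U) (i k : 'I_2).

(* f is extended by 0 outside U in order to use the directional derivative of  *)
(* the library. Derivatives being local, the value outside U is immaterial     *)
(* when U is open.                                                             *)
Definition pderivable i f :=
  forall x, derivable ('valL_ 0 f : 'rV[R]_2 -> R) (val x) (delta_mx 0 i).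

Definition pderiv i f : U -> R :=
  fun x => 'D_(delta_mx 0 i) ('valL_ 0 f : 'rV[R]_2 -> R) (val x).

Fixpoint class_C n f : Prop :=
  continuous f /\
  if n is m.+1 then forall i, pderivable i f /\ class_C m (pderiv i f)
  else True.

Definition smooth f := forall n, class_C n f.

Definition component xi k : U -> R := fun x => xi x 0 k.

Definition smooth_field xi := forall k, smooth (component xi k).

Definition lie_bracket xi eta : vfield R U :=
  fun x => \row_(k < 2) \sum_(r < 2)
    (component xi r x * pderiv r (component eta k) x
     - component eta r x * pderiv r (component xi k) x).

Definition xcoord i : U -> R := fun x => val x 0 i.

Definition fscale f xi : vfield R U := fun x => f x *: xi x.

Definition coord_field i : vfield R U := fun=> delta_mx 0 i.

End Calculus.

Section LinearAlgebra.
Variables (R : fieldType) (V : lmodType R) (n : nat).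

Definition lin_indep (b : n.-tuple V) :=
  forall c : 'I_n -> R, \sum_i c i *: tnth b i = 0 -> forall i, c i = 0.

Definition lin_span (b : n.-tuple V) : set V :=
  [set v | exists c : 'I_n -> R, v = \sum_i c i *: tnth b i].

Definition is_basis (S : set V) (b : n.-tuple V) :=
  lin_indep b /\ lin_span b = S.

End LinearAlgebra.

Definition is_subspace (R : fieldType) (V : lmodType R) (S : set V) :=
  GRing.submod_closed [pred v : V | v \in S].

Definition has_dimension (R : fieldType) (V : lmodType R) (S : set V) (n : nat) :=
  is_subspace S /\ exists b : n.-tuple V, is_basis S b.

Section ThetaHat.
Variables (R : realType) (U : set 'rV[R]_2).

Local Notation d1 := (pderiv i1).
Local Notation d2 := (pderiv i2).

Definition third_order_system (xi : vfield R U) :=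
  forall (k i j r : 'I_2) (x : U),
    pderiv i (pderiv j (pderiv r (component xi k))) x = 0.

Definition second_order_system (xi : vfield R U) :=
  let xi1 := component xi i1 in let xi2 := component xi i2 in
  forall x : U,
  [/\ d2 (d2 xi2) x - d1 (d2 xi1) x = 0,
      d2 (d2 xi1) x + d1 (d2 xi2) x = 0,
      d1 (d2 xi2) x - d1 (d1 xi1) x = 0
    & d1 (d2 xi1) x + d1 (d1 xi2) x = 0].

Definition first_order_system (xi : vfield R U) :=
  let xi1 := component xi i1 in let xi2 := component xi i2 in
  forall x : U, d2 xi2 x - d1 xi1 x = 0 /\ d2 xi1 x + d1 xi2 x = 0.

Definition ThetaHat : set (vfield R U) :=
  [set xi | [/\ smooth_field xi, third_order_system xi,
                second_order_system xi & first_order_system xi]].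

Local Notation x1 := (@xcoord R U i1).
Local Notation x2 := (@xcoord R U i2).
Local Notation D1 := (@coord_field R U i1).
Local Notation D2 := (@coord_field R U i2).

Definition rotation : vfield R U := fscale x1 D2 - fscale x2 D1.

Definition dilatation : vfield R U := fscale x1 D1 + fscale x2 D2.

Definition theta1 : vfield R U :=
  fscale (fun x => 2^-1 * (x1 x ^+ 2 - x2 x ^+ 2)) D1
  + fscale (fun x => x1 x * x2 x) D2.

Definition theta2 : vfield R U :=
  fscale (fun x => x1 x * x2 x) D1
  + fscale (fun x => 2^-1 * (x2 x ^+ 2 - x1 x ^+ 2)) D2.

End ThetaHat.

Arguments ThetaHat {R} U.
Arguments rotation {R} U.
Arguments dilatation {R} U.
Arguments theta1 {R} U.
Arguments theta2 {R} U.

(* Main.v *)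
Require Import Defs.
From mathcomp Require Import all_boot all_order all_algebra.
From mathcomp Require Import all_classical all_reals all_analysis.
From mathcomp Require Import ring lra.
(* By the third order equations the second derivatives of a solution have
   vanishing gradient, hence are constant since U is connected; integrating twice
   shows that the components are quadratic polynomials, and the remaining
   equations reduce their coefficients to six free parameters. Such fields are
   the holomorphic fields of degree at most 2 in z = x^1 + i x^2, on which the
   bracket is a polynomial computation. *)

Set Implicit Arguments.
Unset Strict Implicit.
Unset Printing Implicit Defensive.
Import Order.TTheory.
Import GRing.Theory Num.Theory numFieldNormedType.Exports.
Local Open Scope classical_set_scope.
Local Open Scope ring_scope.

(** * Derivatives along lines *)

Lemma valLE (R : realType) (U : set 'rV[R]_2) (f : U -> R) (x : U) :
  'valL_ 0 f (val x) = f x.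
Proof. exact: (congr1 (@^~ x) (valLK 0 f)). Qed.

(** Both difference quotients are the same function of the increment [h], so one-variable calculus
    applies on each line. *)
Lemma is_derive_line (R : realType) (V : normedModType R) (F : V -> R)
    (p v : V) (t d : R) :
  is_derive (p + t *: v) v F d -> is_derive t 1 (fun s => F (p + s *: v)) d.
Proof.
have E : (fun h => h^-1 *: (((fun s => F (p + s *: v)) \o shift t) (h *: 1)
                            - F (p + t *: v)))
       = (fun h => h^-1 *: ((F \o shift (p + t *: v)) (h *: v)
                            - F (p + t *: v))).
  apply/funext => h /=; congr (_ *: (F _ - _)).
  by rewrite -[h *: 1]/(h * 1) mulr1 scalerDl addrCA.
by case=> der <-; split; [rewrite /derivable E | rewrite /derive E].
Qed.

(** Mean value theorem for [F] restricted to the line. The symmetric range of [t] treats both signs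
    of [s] at once. *)
Lemma is_derive0_line_eq (R : realType) (V : normedModType R) (F : V -> R)
    (p v : V) (s : R) :
  (forall t, `|t| <= `|s| -> is_derive (p + t *: v) v F 0) ->
  F (p + s *: v) = F p.
Proof.
move=> dF; pose h t := F (p + t *: v).
have hE a b : a <= b -> `|a| <= `|s| -> `|b| <= `|s| -> h b = h a.
  move=> ab; rewrite !ler_norml => /andP[a1 a2] /andP[b1 b2].
  have dh t : t \in `[a, b] -> is_derive t 1 h 0.
    rewrite in_itv /= => /andP[at_ tb]; apply/is_derive_line/dF.
    by rewrite ler_norml (le_trans a1) ?(le_trans tb).
  have ch : {within `[a, b], continuous h}.
    by apply: derivable_within_continuous => t /dh[].
  have doo t : t \in `]a, b[ -> is_derive t 1 h ((fun=> 0) t).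
    by move=> /subset_itv_oo_cc; exact: dh.
  have [c _] := MVT_segment ab doo ch.
  by rewrite mul0r => /eqP; rewrite subr_eq0 => /eqP.
suff : h s = h 0 by rewrite /h scale0r addr0.
have [s0|/ltW s0] := leP 0 s; first by rewrite (hE 0 s) ?normr0.
by rewrite (hE s 0) ?normr0.
Qed.

(** * Partial derivatives on an open set, and functions with vanishing gradient *)

Section Plane.
Variables (R : realType) (U : set 'rV[R]_2).
Hypothesis U_open : open U.
Implicit Types (f g : U -> R) (i : 'I_2) (x y : U).

Lemma nbhs_val x : nbhs (val x) U.
Proof. by apply: open_nbhs_nbhs; split=> //; exact: set_valP. Qed.

Lemma pderivable_is_derive i f x : pderivable i f ->
  is_derive (val x) (delta_mx 0 i) ('valL_ 0 f) (pderiv i f x).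
Proof. by move=> /(_ x); split. Qed.

(** Near a point of the open set [U] the zero extension of [f] agrees with [G], and derivatives are
    local. This computes [pderiv] from a formula valid on the whole plane. *)
Lemma pderiv_unique (G : 'rV[R]_2 -> R) i f (d : U -> R) :
  (forall x, f x = G (val x)) ->
  (forall x, is_derive (val x) (delta_mx 0 i) G (d x)) ->
  pderivable i f /\ pderiv i f = d.
Proof.
move=> fG dG.
suff df x : is_derive (val x) (delta_mx 0 i) ('valL_ 0 f) (d x).
  by split=> [x|]; [case: (df x)|apply/funext => x; case: (df x)].
apply: near_eq_is_derive (dG x).
apply: filterS (nbhs_val x) => y /mem_set Uy.
by rewrite -[y]/(val (SigSub Uy)) valLE fG.
Qed.

Lemma row2_decomp (v : 'rV[R]_2) :
  v = v 0 i1 *: delta_mx 0 i1 + v 0 i2 *: delta_mx 0 i2.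
Proof.
rewrite {1}[v]row_sum_delta big_ord_recl big_ord1.
by congr (_ + _ *: delta_mx _ _); [congr (v _ _)|]; apply: val_inj.
Qed.

(** Balls are entrywise, hence squares: [q] is reached from [p] by a segment along the first axis
    and then one along the second, both inside a ball contained in [U]. [F] is constant on each
    segment. *)
Lemma pderiv0_local f : (forall i, pderivable i f) ->
  (forall i x, pderiv i f x = 0) ->
  forall p, U p -> \forall q \near p, U q /\ 'valL_ 0 f q = 'valL_ 0 f p.
Proof.
set F := 'valL_ 0 f => df f0 p Up.
have dF i q : U q -> is_derive q (delta_mx 0 i) F 0.
  move=> /mem_set Uq.
  by have := pderivable_is_derive (SigSub Uq) (df i); rewrite f0.
have /nbhs_ballP[e /= e0 peU] : nbhs p U by exact: open_nbhs_nbhs.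
apply/nbhs_ballP; exists e => // q pq; split; first exact: peU.
have pqE i : `|q 0 i - p 0 i| < e by rewrite distrC; by have [_] := pq; exact.
have -> : q = (p + (q 0 i1 - p 0 i1) *: delta_mx 0 i1)
              + (q 0 i2 - p 0 i2) *: delta_mx 0 i2.
  by have := row2_decomp (q - p); rewrite !mxE -addrA => <-; rewrite addrC subrK.
have pqU s t : `|s| <= `|q 0 i1 - p 0 i1| -> `|t| <= `|q 0 i2 - p 0 i2| ->
    U (p + s *: delta_mx 0 i1 + t *: delta_mx 0 i2).
  move=> /le_lt_trans/(_ (pqE _)) se /le_lt_trans/(_ (pqE _)) te.
  apply: peU; split=> // a j; rewrite ord1 /ball /= !mxE /=.
  have [->|->] : j = i1 \/ j = i2.
    by case: j => -[|[|//]] jlt; [left|right]; apply: val_inj.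
  - by rewrite mulr1 mulr0 addr0 opprD addNKr normrN.
  - by rewrite mulr1 mulr0 addr0 opprD addNKr normrN.
transitivity (F (p + (q 0 i1 - p 0 i1) *: delta_mx 0 i1)).
  by apply: is_derive0_line_eq => t tle; apply: dF; exact: pqU.
apply: is_derive0_line_eq => t tle; apply: dF.
by have := pqU t 0; rewrite scale0r addr0; apply; rewrite // normr0.
Qed.

(** By local constancy, the part of [U] where [f] takes the value [f y] and the part where it does
    not are both open. *)
Lemma pderiv0_cst f : connected U -> (forall i, pderivable i f) ->
  (forall i x, pderiv i f x = 0) -> forall x y, f x = f y.
Proof.
move=> cU df f0 x y.
have loc := @pderiv0_local f df f0.
pose F := 'valL_ 0 f; pose B := U `&` [set p | F p = F (val y)].
pose C := U `&` [set p | F p <> F (val y)].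
have oB : open B.
  rewrite openE => p [Up Fp]; apply: filterS (loc p Up) => q [Uq Fq].
  by split=> //; rewrite /= /F Fq.
have oC : open C.
  rewrite openE => p [Up Fp]; apply: filterS (loc p Up) => q [Uq Fq].
  by split=> //; rewrite /= /F Fq.
have BU : B = U.
  apply: cU.
  - by exists (val y); split=> //; exact: set_valP.
  - by exists B => //; rewrite /B setIA setIid.
  (* [B] is relatively closed in [U], being cut out by the closed complement of [C]. *)
  - exists (~` C); first exact: open_closedC.
    apply/seteqP; split=> p [Up Fp]; split=> //; first by case.
    by apply: contrapT => /= Fp'; exact: Fp.
have [_ /=] : B (val x) by rewrite BU; exact: set_valP.
by rewrite /F !valLE.
Qed.

Lemma pderiv_eq_cst f g : connected U -> U !=set0 ->
  (forall i, pderivable i f) -> (forall i, pderivable i g) ->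
  (forall i x, pderiv i f x = pderiv i g x) ->
  exists c, forall x, f x = c + g x.
Proof.
move=> cU [p /mem_set Up] df dg fg.
have dfg i x : is_derive (val x) (delta_mx 0 i) ('valL_ 0 (f \- g)) 0.
  have dF := pderivable_is_derive x (df i).
  have dG := pderivable_is_derive x (dg i).
  apply: (@near_eq_is_derive _ _ _ ('valL_ 0 f \- 'valL_ 0 g)).
    apply: filterS (nbhs_val x) => y /mem_set Uy.
    rewrite -[y]/(val (SigSub Uy)).
    by rewrite -[LHS]/('valL_ 0 f _ - 'valL_ 0 g _) !valLE.
  by apply: is_derive_eq; rewrite fg subrr.
exists (f (SigSub Up) - g (SigSub Up)) => x.
apply/eqP; rewrite -subr_eq; apply/eqP.
apply: (@pderiv0_cst (f \- g)) => // i y; first by case: (dfg i y).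
by case: (dfg i y).
Qed.

End Plane.

(** * Coordinate functions and quadratic polynomials *)

Lemma is_derive_coord (R : realType) (m n : nat) (p v : 'M[R]_(m.+1, n.+1))
    (i : 'I_m.+1) (j : 'I_n.+1) :
  is_derive p v (fun q : 'M[R]_(m.+1, n.+1) => q i j) (v i j).
Proof.
have H : h^-1 *: (((fun q : 'M[R]_(m.+1, n.+1) => q i j) \o shift p) (h *: v)
    - p i j) @[h --> (0 : R)^'] --> v i j.
  (* Coordinates are linear, so the quotient equals [v i j] for every nonzero [h]. *)
  apply: cvg_near_cst; near=> h.
  rewrite /= !mxE addrK -[_ *: _]/(_ * _) mulKf //.
  by near: h; exact: nbhs_dnbhs_neq.
by split; [exact: cvgP H | exact: cvg_lim H].
Unshelve. all: by end_near. Qed.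

Section Quadratic.
Variable R : realType.

(** Constants and affine functions are included with zero leading coefficients, so the family is
    stable under partial derivatives. *)
Definition quad (c0 c1 c2 c11 c12 c22 : R) (p : 'rV[R]_2) : R :=
  c0 + c1 * p 0 i1 + c2 * p 0 i2
  + c11 * (p 0 i1 * p 0 i1) + c12 * (p 0 i1 * p 0 i2) + c22 * (p 0 i2 * p 0 i2).

Lemma is_derive_quad c0 c1 c2 c11 c12 c22 (p v : 'rV[R]_2) :
  is_derive p v (quad c0 c1 c2 c11 c12 c22)
    (v 0 i1 * quad c1 (2 * c11) c12 0 0 0 p
     + v 0 i2 * quad c2 c12 (2 * c22) 0 0 0 p).
Proof.
have d1 := is_derive_coord p v 0 i1.
have d2 := is_derive_coord p v 0 i2.
apply: is_derive_eq.
rewrite /quad /GRing.scale /=; ring.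
Qed.

Lemma quad_continuous c0 c1 c2 c11 c12 c22 :
  continuous (quad c0 c1 c2 c11 c12 c22).
Proof.
have cc (c : R) : continuous (fun _ : 'rV[R]_2 => c).
  exact: cst_continuous.
have cx i : continuous (fun p : 'rV[R]_2 => p 0 i) by exact: coord_continuous.
have cM (f g : 'rV[R]_2 -> R) : continuous f -> continuous g ->
    continuous (fun p => f p * g p).
  by move=> cf cg p; exact: (cvgM (cf p) (cg p)).
have cD (f g : 'rV[R]_2 -> R) : continuous f -> continuous g ->
    continuous (fun p => f p + g p).
  by move=> cf cg p; exact: (cvgD (cf p) (cg p)).
have cl c i := cM _ _ (cc c) (cx i).
have cq c i j := cM _ _ (cc c) (cM _ _ (cx i) (cx j)).
exact: (cD _ _ (cD _ _ (cD _ _ (cD _ _ (cD _ _ (cc c0) (cl c1 i1))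
  (cl c2 i2)) (cq c11 i1 i1)) (cq c12 i1 i2)) (cq c22 i2 i2)).
Qed.

End Quadratic.

Section SmoothFunctions.
Variables (R : realType) (U : set 'rV[R]_2).
Implicit Types (f : U -> R) (i : 'I_2).

Lemma smooth_pderivable i f : smooth f -> pderivable i f.
Proof. by move=> /(_ 1%N)[_ /(_ i)[]]. Qed.

Lemma smooth_pderiv i f : smooth f -> smooth (pderiv i f).
Proof. by move=> sf n; have [_ /(_ i)[]] := sf n.+1. Qed.

End SmoothFunctions.

Lemma ord2P (i : 'I_2) : i = i1 \/ i = i2.
Proof. by case: i => -[|[|//]] ilt; [left|right]; apply: val_inj. Qed.

Lemma sum_ord2 (V : nmodType) (F : 'I_2 -> V) : \sum_i F i = F i1 + F i2.
Proof.
rewrite big_ord_recl big_ord1; congr (F _ + F _); exact: val_inj.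
Qed.

Section QuadraticOnOpen.
Variables (R : realType) (U : set 'rV[R]_2).
Hypothesis U_open : open U.

Local Notation Q c0 c1 c2 c11 c12 c22 :=
  (fun x : U => quad c0 c1 c2 c11 c12 c22 (val x)).

Lemma pderiv_quad1 c0 c1 c2 c11 c12 c22 :
  pderivable i1 (Q c0 c1 c2 c11 c12 c22) /\
  pderiv i1 (Q c0 c1 c2 c11 c12 c22) = Q c1 (2 * c11) c12 0 0 0.
Proof.
apply: (pderiv_unique U_open (G := quad c0 c1 c2 c11 c12 c22)) => // x.
apply: is_derive_eq (is_derive_quad _ _ _ _ _ _ _ _) _.
by rewrite !mxE /= mul0r addr0 mul1r.
Qed.

Lemma pderiv_quad2 c0 c1 c2 c11 c12 c22 :
  pderivable i2 (Q c0 c1 c2 c11 c12 c22) /\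
  pderiv i2 (Q c0 c1 c2 c11 c12 c22) = Q c2 c12 (2 * c22) 0 0 0.
Proof.
apply: (pderiv_unique U_open (G := quad c0 c1 c2 c11 c12 c22)) => // x.
apply: is_derive_eq (is_derive_quad _ _ _ _ _ _ _ _) _.
by rewrite !mxE /= mul0r add0r mul1r.
Qed.

(** Induction on the order for all coefficients at once, since the partial derivatives are again of
    the form [quad]. *)
Lemma smooth_quad c0 c1 c2 c11 c12 c22 : smooth (Q c0 c1 c2 c11 c12 c22).
Proof.
move=> n; elim: n c0 c1 c2 c11 c12 c22 => [|n IHn] c0 c1 c2 c11 c12 c22.
all: have cQ : continuous (Q c0 c1 c2 c11 c12 c22) by
  move=> x; apply: continuous_comp;
    [exact: initial_continuous|exact: quad_continuous].
- by [].
split=> // i; have [->|->] := ord2P i.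
- by have [dQ ->] := pderiv_quad1 c0 c1 c2 c11 c12 c22.
- by have [dQ ->] := pderiv_quad2 c0 c1 c2 c11 c12 c22.
Qed.

(** The coefficients are read off from derivatives at a single point of [U]: first those of degree
    2, then those of degree 1, then [c0]. *)
Lemma quad_eq0 c0 c1 c2 c11 c12 c22 : U !=set0 ->
  (forall x : U, quad c0 c1 c2 c11 c12 c22 (val x) = 0) ->
  [/\ c0 = 0, c1 = 0, c2 = 0 & [/\ c11 = 0, c12 = 0 & c22 = 0]].
Proof.
move=> [p /mem_set Up] Q0.
have z0 a0 a1 a2 a11 a12 a22 : Q a0 a1 a2 a11 a12 a22 = (fun=> 0) ->
    Q a1 (2 * a11) a12 0 0 0 = (fun=> 0) /\
    Q a2 a12 (2 * a22) 0 0 0 = (fun=> 0).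
  (* Written as a [quad], the zero function is differentiated by the same formulas. *)
  have -> : (fun=> 0) = Q 0 0 0 0 0 0.
    by apply/funext => x; rewrite /quad; ring.
  move=> E; rewrite -(pderiv_quad1 a0 a1 a2 a11 a12 a22).2.
  rewrite -(pderiv_quad2 a0 a1 a2 a11 a12 a22).2 E.
  rewrite (pderiv_quad1 _ _ _ _ _ _).2 (pderiv_quad2 _ _ _ _ _ _).2.
  by split; apply/funext => x; rewrite /quad; ring.
have [/[dup] E1 /z0[E11 E12] /[dup] E2 /z0[_ E22]] :=
  z0 _ _ _ _ _ _ (funext Q0).
have at_p f : f = (fun=> 0) -> f (SigSub Up) = 0 :> R by move=> ->.
move: (Q0 (SigSub Up)) (at_p _ E1) (at_p _ E2).
move: (at_p _ E11) (at_p _ E12) (at_p _ E22).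
rewrite /quad !(mul0r, mulr0, addr0) => c11_0 -> c22_0.
have -> : c11 = 0 by lra.
have -> : c22 = 0 by lra.
rewrite !(mul0r, mulr0, addr0) => + c1_0 c2_0.
by rewrite c1_0 c2_0 !(mul0r, addr0).
Qed.

(** The polynomial with constant term 0 has the same gradient as [f], so the two differ by a
    constant, which becomes [c0]. *)
Lemma quad_primitive f c1 c2 c11 c12 c22 : connected U -> U !=set0 ->
  (forall i, pderivable i f) ->
  (forall x : U, pderiv i1 f x = quad c1 (2 * c11) c12 0 0 0 (val x)) ->
  (forall x : U, pderiv i2 f x = quad c2 c12 (2 * c22) 0 0 0 (val x)) ->
  exists c0, forall x : U, f x = quad c0 c1 c2 c11 c12 c22 (val x).
Proof.
move=> cU U0 df f1 f2.
have [dQ1 EQ1] := pderiv_quad1 0 c1 c2 c11 c12 c22.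
have [dQ2 EQ2] := pderiv_quad2 0 c1 c2 c11 c12 c22.
have [||c0 fE] := @pderiv_eq_cst R U U_open f (Q 0 c1 c2 c11 c12 c22) cU U0 df.
- by move=> i; have [->|->] := ord2P i.
- by move=> i x; have [->|->] := ord2P i; rewrite ?EQ1 ?EQ2.
by exists c0 => x; rewrite fE /quad; ring.
Qed.

End QuadraticOnOpen.

(** * Conformal fields, their brackets, and the solution of the system *)

Section Conformal.
Variables (R : realType) (U : set 'rV[R]_2).

(* In the complex coordinate z = x^1 + i x^2 this is A + B z + C z^2 / 2 with
   A = a + i b, B = s + i r, C = u - i v; the bracket of F and G is then
   F G' - G F'. *)
Definition conformal (a b r s u v : R) : vfield R U := fun x => \row_k
  if k == i1 then quad a s (- r) (2^-1 * u) v (- (2^-1 * u)) (val x)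
  else quad b r s (- (2^-1 * v)) u (2^-1 * v) (val x).

Lemma vfield_ext (xi eta : vfield R U) :
  (forall x, component xi i1 x = component eta i1 x) ->
  (forall x, component xi i2 x = component eta i2 x) -> xi = eta.
Proof.
move=> E1 E2; apply/funext => x; apply/rowP => k.
by have [->|->] := ord2P k; [exact: E1|exact: E2].
Qed.

Lemma conformal1 a b r s u v : component (conformal a b r s u v) i1 =
  (fun x => quad a s (- r) (2^-1 * u) v (- (2^-1 * u)) (val x)).
Proof. by apply/funext => x; rewrite /component mxE eqxx. Qed.

Lemma conformal2 a b r s u v : component (conformal a b r s u v) i2 =
  (fun x => quad b r s (- (2^-1 * v)) u (2^-1 * v) (val x)).
Proof. by apply/funext => x; rewrite /component mxE. Qed.

Lemma conformalE a b r s u v : conformal a b r s u v =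
  a *: (@coord_field R U i1 : vfield R U)
  + (b *: (@coord_field R U i2 : vfield R U) + (r *: rotation U
  + (s *: dilatation U + (u *: theta1 U + v *: theta2 U)))).
Proof.
apply: vfield_ext => x; rewrite ?conformal1 ?conformal2 /component.
  rewrite /rotation /dilatation /theta1 /theta2 /fscale /coord_field /xcoord.
  by rewrite !fctE !mxE /quad /=; ring.
rewrite /rotation /dilatation /theta1 /theta2 /fscale /coord_field /xcoord.
by rewrite !fctE !mxE /quad /=; ring.
Qed.

Hypothesis U_open : open U.

Lemma conformal_ThetaHat a b r s u v : ThetaHat U (conformal a b r s u v).
Proof.
have d1 c0 c1 c2 c11 c12 c22 :=
  (pderiv_quad1 U_open c0 c1 c2 c11 c12 c22).2.
have d2 c0 c1 c2 c11 c12 c22 :=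
  (pderiv_quad2 U_open c0 c1 c2 c11 c12 c22).2.
split.
- move=> k; have [->|->] := ord2P k; rewrite ?conformal1 ?conformal2;
    exact: smooth_quad.
- move=> k i j l x.
  have [->|->] := ord2P k; rewrite ?conformal1 ?conformal2;
  have [->|->] := ord2P l; rewrite ?d1 ?d2;
  have [->|->] := ord2P j; rewrite ?d1 ?d2;
  have [->|->] := ord2P i; rewrite ?d1 ?d2 /quad; ring.
- by move=> x; rewrite conformal1 conformal2 !(d1, d2) /quad; split; field.
- by move=> x; rewrite conformal1 conformal2 !(d1, d2) /quad; split; field.
Qed.

(** In complex form the cubic terms and the products [B B'] cancel in [F G' - G F'], leaving [(A B'
    - A' B) + (A C' - A' C) z + (B C' - B' C) z^2 / 2]; the six arguments are the real and imaginary
    parts, up to the sign convention for [v]. *)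
Lemma lie_bracket_conformal a b r s u v a' b' r' s' u' v' :
  lie_bracket (conformal a b r s u v) (conformal a' b' r' s' u' v') =
  conformal (a * s' - b * r' - (a' * s - b' * r))
            (a * r' + b * s' - (a' * r + b' * s))
            (b * u' - a * v' - (b' * u - a' * v))
            (a * u' + b * v' - (a' * u + b' * v))
            (s * u' + r * v' - (s' * u + r' * v))
            (s * v' - r * u' - (s' * v - r' * u)).
Proof.
have d1 c0 c1 c2 c11 c12 c22 :=
  (pderiv_quad1 U_open c0 c1 c2 c11 c12 c22).2.
have d2 c0 c1 c2 c11 c12 c22 :=
  (pderiv_quad2 U_open c0 c1 c2 c11 c12 c22).2.
apply: vfield_ext => x; rewrite ?conformal1 ?conformal2 /component mxE sum_ord2;
  rewrite !conformal1 !conformal2 !(d1, d2) /quad; by field.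
Qed.

(** Repeated use of [quad_primitive]: second derivatives are constant, first derivatives affine,
    components quadratic. The constants of integration supply the parameters. *)
Lemma ThetaHat_conformal xi : connected U -> U !=set0 -> ThetaHat U xi ->
  exists a b r s u v, xi = conformal a b r s u v.
Proof.
move=> cU U0 [sm third second first].
set xi1 := component xi i1 in second first.
set xi2 := component xi i2 in second first.
have prim f c1 c2 c11 c12 c22 :=
  @quad_primitive R U U_open f c1 c2 c11 c12 c22 cU U0.
have E1 : pderiv i2 xi2 = pderiv i1 xi1.
  by apply/funext => x; have [/eqP] := first x; rewrite subr_eq0 => /eqP.
have E2 x : pderiv i1 xi2 x = - pderiv i2 xi1 x.
  by have [_ /eqP] := first x; rewrite addrC addr_eq0 => /eqP.
have pdb i k : pderivable i (component xi k) by exact: smooth_pderivable.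
have pdb1 i j k : pderivable i (pderiv j (component xi k)).
  exact/smooth_pderivable/smooth_pderiv.
have cst2 j l k : exists c, forall x, pderiv j (pderiv l (component xi k)) x = c.
  have [i|x|x|c cE] := prim (pderiv j (pderiv l (component xi k))) 0 0 0 0 0.
  - exact/smooth_pderivable/smooth_pderiv/smooth_pderiv.
  - by rewrite third /quad; ring.
  - by rewrite third /quad; ring.
  by exists c => x; rewrite cE /quad; ring.
(* The two second derivatives of [xi1] named here fix all the quadratic coefficients of both
   components. *)
have [u uE] := cst2 i1 i1 i1.
have [v vE] := cst2 i2 i1 i1.
have [i|x|x|s sE] := prim (pderiv i1 xi1) u v 0 0 0.
- exact: pdb1.
- by rewrite uE /quad; ring.
- by rewrite vE /quad; ring.
(* Differentiating the first order equations and comparing with the second order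
   ones gives d1 d2 xi1 = d2 d1 xi1, so Schwarz's theorem is not needed. *)
have [i|x|x|q qE] := prim (pderiv i2 xi1) v (- u) 0 0 0.
- exact: pdb1.
- have [/eqP + _ _ _] := second x; rewrite subr_eq0 E1 vE => /eqP <-.
  by rewrite /quad; ring.
- have [_ /eqP + _ _] := second x; rewrite addr_eq0 E1 uE => /eqP ->.
  by rewrite /quad; ring.
have [i|x|x|a aE] := prim xi1 s q (2^-1 * u) v (- (2^-1 * u)).
- exact: pdb.
- by rewrite sE /quad; field.
- by rewrite qE /quad; field.
(* The Cauchy-Riemann equations [E1] and [E2] give the gradient of [xi2] from that of [xi1]; only
   the constant [b] is new. *)
have [i|x|x|b bE] := prim xi2 (- q) s (- (2^-1 * v)) u (2^-1 * v).
- exact: pdb.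
- by rewrite E2 qE /quad; field.
- by rewrite E1 sE /quad; field.
exists a, b, (- q), s, u, v; apply: vfield_ext => x.
- by rewrite conformal1 opprK; exact: aE.
- by rewrite conformal2; exact: bE.
Qed.

End Conformal.

Arguments conformal {R} U a b r s u v.

(** * The basis *)

Lemma lin_span_subspace (K : fieldType) (V : lmodType K) (n : nat)
  (b : n.-tuple V) : is_subspace (lin_span b).
Proof.
split=> [|k x y]; rewrite !inE.
  by exists (fun=> 0); rewrite big1 // => i _; rewrite scale0r.
move=> [c ->] [d ->]; exists (fun i => k * c i + d i).
rewrite scaler_sumr -big_split; apply: eq_bigr => i _ /=.
by rewrite scalerDl scalerA.
Qed.

Section Basis.
Variables (R : realType) (U : set 'rV[R]_2).
Hypotheses (U_nonempty : U !=set0) (U_open : open U).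
Hypothesis U_connected : connected U.

Local Notation basis_tuple := ([tuple (@coord_field R U i1 : vfield R U);
  (@coord_field R U i2 : vfield R U); rotation U; dilatation U; theta1 U;
  theta2 U]).

(** Turns independence and spanning into statements about the six parameters of [conformal]. *)
Lemma sum_basis_tuple (c : 'I_6 -> R) :
  \sum_i c i *: tnth basis_tuple i =
  conformal U (c (inord 0)) (c (inord 1)) (c (inord 2)) (c (inord 3))
    (c (inord 4)) (c (inord 5)).
Proof.
rewrite conformalE !big_ord_recl big_ord0 addr0.
by do ![congr (_ + _)]; congr (c _ *: _); apply: val_inj; rewrite /= inordK.
Qed.

Lemma conformal_eq0 (a b r s u v : R) : conformal U a b r s u v = 0 ->
  [/\ a = 0, b = 0, r = 0 & [/\ s = 0, u = 0 & v = 0]].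
Proof.
move=> E0.
have Q1 x : component (conformal U a b r s u v) i1 x = 0.
  by rewrite E0 /component mxE.
have Q2 x : component (conformal U a b r s u v) i2 x = 0.
  by rewrite E0 /component mxE.
rewrite conformal1 in Q1; rewrite conformal2 in Q2.
(* The mixed coefficients of the two components are [v] and [u]; constant and linear terms give the
   other four parameters. *)
have [-> _ _ [_ -> _]] := quad_eq0 U_open U_nonempty Q1.
by have [-> -> -> [/eqP + -> _]] := quad_eq0 U_open U_nonempty Q2.
Qed.

Lemma ThetaHat_basis : is_basis (ThetaHat U) basis_tuple.
Proof.
split=> [c|].
  rewrite sum_basis_tuple => /conformal_eq0[c0 c1 c2 [c3 c4 c5]] i.
  have -> : i = inord i by apply: val_inj; rewrite /= inordK.
  by case: i => -[|[|[|[|[|[|//]]]]]] /= _.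
apply/seteqP; split=> [xi [c ->]|xi].
  by rewrite sum_basis_tuple; exact: conformal_ThetaHat.
move=> /(ThetaHat_conformal U_open U_connected U_nonempty)
  [a [b [r [s [u [v ->]]]]]].
exists (tnth [tuple a; b; r; s; u; v]); rewrite sum_basis_tuple.
by congr conformal; rewrite (tnth_nth 0) /= inordK.
Qed.

End Basis.

Theorem mainTheorem1 (R : realType) (U : set 'rV[R]_2)
    (U_nonempty : U !=set0) (U_open : open U) (U_connected : connected U) :
  let del1 : vfield R U := coord_field i1 in
  let del2 : vfield R U := coord_field i2 in
  let rot : vfield R U := rotation U in
  let dil : vfield R U := dilatation U in
  let th1 : vfield R U := theta1 U in
  let th2 : vfield R U := theta2 U in
  [/\ has_dimension (ThetaHat U) 6,
      is_basis (ThetaHat U) [tuple del1; del2; rot; dil; th1; th2],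
      forall xi eta : vfield R U,
        ThetaHat U xi -> ThetaHat U eta -> ThetaHat U (lie_bracket xi eta)
    & [/\ lie_bracket del1 th1 = dil,
          lie_bracket del2 th1 = rot,
          lie_bracket rot th1 = - th2,
          lie_bracket dil th1 = th1
        & lie_bracket th1 th2 = 0]].
Proof.
move=> del1 del2 rot dil th1 th2.
have basis : is_basis (ThetaHat U) [tuple del1; del2; rot; dil; th1; th2].
  exact: ThetaHat_basis.
(* The solution set is the span of its basis, hence a subspace. *)
have subspace : is_subspace (ThetaHat U).
  by rewrite -basis.2; exact: lin_span_subspace.
(* Each basis field is the conformal field with one parameter 1 and the others 0, so the brackets
   below reduce to arithmetic on parameters. *)
have [del1E del2E] : del1 = conformal U 1 0 0 0 0 0 /\
                     del2 = conformal U 0 1 0 0 0 0.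
  by rewrite !conformalE !scale0r !scale1r !addr0 !add0r.
have [rotE dilE] : rot = conformal U 0 0 1 0 0 0 /\
                   dil = conformal U 0 0 0 1 0 0.
  by rewrite !conformalE !scale0r !scale1r !addr0 !add0r.
have [th1E th2E] : th1 = conformal U 0 0 0 0 1 0 /\
                   th2 = conformal U 0 0 0 0 0 1.
  by rewrite !conformalE !scale0r !scale1r !addr0 !add0r.
split=> //.
- by split=> //; exists [tuple del1; del2; rot; dil; th1; th2].
- move=> xi eta.
  move=> /(ThetaHat_conformal U_open U_connected U_nonempty)
    [a [b [r [s [u [v ->]]]]]].
  move=> /(ThetaHat_conformal U_open U_connected U_nonempty)
    [a' [b' [r' [s' [u' [v' ->]]]]]].
  by rewrite lie_bracket_conformal //; exact: conformal_ThetaHat.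
have opp_th2 : - th2 = conformal U 0 0 0 0 0 (- 1).
  by rewrite conformalE !scale0r !add0r scaleN1r.
have zeroE : 0 = conformal U 0 0 0 0 0 0.
  by rewrite conformalE !scale0r !add0r.
rewrite opp_th2 zeroE del1E del2E rotE dilE th1E th2E.
by split; rewrite lie_bracket_conformal //; congr conformal; ring.
Qed.
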